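(* Let $Q=(q_{ij})$ be an (irreducible) single birth $Q$-matrix on $\mathbb Z_+$ whose process is recurrent. Let $\lambda>0$ and define $\big(\widetilde F_k^{(i)}\big)$ and $\big(\tilde d_k\big)$ as in the context with $c_i\equiv-\lambda$. Then the Laplace transform of $\sigma_0$ is given by $$\mathbb E_0e^{-\lambda\sigma_0}=\frac{q_{01}(1-\lambda\tilde d)}{q_{01}+\lambda},\qquad \mathbb E_ne^{-\lambda\sigma_0}=1-\lambda\sum_{k=0}^{n-1}\Big(\widetilde F_k^{(0)}\tilde d-\tilde d_k\Big),\qquad n\ge 1,$$ where $$\tilde d=\lim_{n\to\infty}\frac{\sum_{k=0}^{n-1}\tilde d_k}{\sum_{k=0}^{n-1}\widetilde F_k^{(0)}},$$ and $\tilde d=\lim_{n\to\infty}\tilde d_n/\widetilde F_n^{(0)}$ if the latter limit exists.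
   Context: A single birth $Q$-matrix on $\mathbb Z_+=\{0,1,2,\dots\}$ is a real matrix $Q=(q_{ij})$ with $q_{ij}\ge 0$ for $i\neq j$, which is conservative ($\sum_j q_{ij}=0$ for every $i$), irreducible, and satisfies $q_{i,i+1}>0$ and $q_{i,i+j}=0$ for all $i\in\mathbb Z_+$ and $j\ge 2$. $X(t)$ is the corresponding continuous-time Markov chain, $\mathbb E_n$ is expectation for the chain started at $n$, and $\sigma_0=\inf\{t\ge\eta_1:X(t)=0\}$, where $\eta_1$ is the first jump time. For a real function $c=(c_n)$ define $\tilde q_n^{(k)}=\sum_{j=0}^kq_{nj}-c_n$ for $0\le k<n$, $$\widetilde F_i^{(i)}=1,\qquad \widetilde F_n^{(i)}=\frac1{q_{n,n+1}}\sum_{k=i}^{n-1}\tilde q_n^{(k)}\widetilde F_k^{(i)},\qquad n>i\ge 0,$$ $$\tilde d_0=0,\qquad \tilde d_n=\frac1{q_{n,n+1}}\Bigg(1+\sum_{k=0}^{n-1}\tilde q_n^{(k)}\tilde d_k\Bigg),\qquad n\ge 1.$$ *)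

(* Defs.v *)
From HB Require Import structures.
From mathcomp Require Import all_boot all_order all_algebra.
From mathcomp Require Import all_classical all_reals all_analysis.
Set Implicit Arguments.
Unset Strict Implicit.
Unset Printing Implicit Defensive.
Import Order.TTheory GRing.Theory Num.Theory.
Import numFieldNormedType.Exports.
Local Open Scope classical_set_scope.
Local Open Scope ring_scope.

Definition irreducible_Q (R : realType) (Q : nat -> nat -> R) : Prop :=
  forall i j : nat, exists p : seq nat,
    path (fun a b => 0 < Q a b) i p /\ last i p = j.

Record single_birth_Qmatrix (R : realType) (Q : nat -> nat -> R) : Prop := {
  Qoffdiag_ge0 : forall i j : nat, i != j -> 0 <= Q i j;
  Qconservative : forall i : nat,
    (fun n => \sum_(0 <= j < n) Q i j) @ \oo --> (0 : R);
  Qirreducible : irreducible_Q Q;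
  Qbirth_gt0 : forall i : nat, 0 < Q i i.+1;
  Qskipfree : forall i j : nat, (2 <= j)%N -> Q i (i + j)%N = 0 }.

Definition jump_prob (R : realType) (Q : nat -> nat -> R) (i j : nat) : R :=
  if j == i then 0 else Q i j / - Q i i.

(* The path w of X is the right-continuous step path with jump chain
   Y 0, Y 1, ... and holding times S 0, S 1, ...; from the explosion time
   \sum_k S k w on, if it is finite, X sits in the cemetery None. *)
Definition step_path (R : realType) (T : Type) (X : R -> T -> option nat)
    (Y : nat -> T -> nat) (S : nat -> T -> R) (w : T) : Prop :=
  let J (m : nat) : R := \sum_(0 <= k < m) S k w in
  [/\ forall m, 0 < S m w,
      forall m, Y m.+1 w <> Y m w,
      forall m t, J m <= t < J m.+1 -> X t w = Some (Y m w) &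
      forall t, (forall m, J m <= t) -> X t w = None].

(* X is, under the laws P 0, P 1, ..., the (minimal) continuous-time Markov
   chain with conservative Q-matrix Q, P n being the law of the chain started
   at n: the jump chain has transition probabilities q_ij / q_i and, given the
   jump chain, the holding times are independent and exponential with rates
   q_(Y k), where q_i = - Q i i.  Only the times t >= 0 of X t matter. *)
Definition markov_chain (R : realType) (Q : nat -> nat -> R)
    (d : measure_display) (T : measurableType d) (P : nat -> probability T R)
    (X : R -> T -> option nat) : Prop :=
  exists (Y : nat -> T -> nat) (S : nat -> T -> R),
    [/\ forall m, measurable_fun setT (Y m),
        forall m, measurable_fun setT (S m),
        forall w, step_path X Y S w &
        forall (n m : nat) (i : nat -> nat) (s : nat -> R),
          (forall k, 0 <= s k) ->
          P n [set w | forall k, (k <= m)%N -> Y k w = i k /\ s k < S k w] =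
          ((i 0%N == n)%:R *
           (\prod_(0 <= k < m) jump_prob Q (i k) (i k.+1)) *
           \prod_(0 <= k < m.+1) expR (- (- Q (i k) (i k)) * s k))%:E].

Definition first_jump (R : realType) (T : Type) (X : R -> T -> option nat)
    (w : T) : \bar R :=
  ereal_inf [set t%:E | t in [set t : R | 0 <= t /\ X t w <> X 0 w]].

Definition return_time (R : realType) (T : Type) (X : R -> T -> option nat)
    (i : nat) (w : T) : \bar R :=
  ereal_inf [set t%:E | t in
    [set t : R | [/\ 0 <= t, (first_jump X w <= t%:E)%E & X t w = Some i]]].

Definition recurrent_chain (R : realType) (d : measure_display)
    (T : measurableType d) (P : nat -> probability T R)
    (X : R -> T -> option nat) : Prop :=
  forall i : nat, P i [set w | (return_time X i w < +oo)%E] = 1%E.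

(* exp(- lam * sigma) is 0 where sigma = +oo, as expeR -oo = 0. *)
Definition laplace (R : realType) (d : measure_display)
    (T : measurableType d) (P : probability T R) (sigma : T -> \bar R)
    (lam : R) : \bar R :=
  (\int[P]_w expeR (- (lam%:E * sigma w)))%E.

(* Course-of-values recursion: course f n = f n [:: course f 0; ...;
   course f n.-1]. *)
Fixpoint history (A : Type) (f : nat -> seq A -> A) (n : nat) : seq A :=
  if n is m.+1 then rcons (history f m) (f m (history f m)) else [::].

Definition course (A : Type) (f : nat -> seq A -> A) (n : nat) : A :=
  f n (history f n).

Lemma nth_history (A : Type) (f : nat -> seq A -> A) (a : A) (n k : nat) :
  (k < n)%N -> nth a (history f n) k = course f k.
Proof.
have szh m : size (history f m) = m by elim: m => //= m IH; rewrite size_rcons IH.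
elim: n => // n IH; rewrite ltnS leq_eqVlt => /orP[/eqP ->|kn] /=;
  by rewrite nth_rcons szh ?ltnn ?eqxx // kn IH.
Qed.

Section Sequences.
Variables (R : realType) (Q : nat -> nat -> R) (c : nat -> R).

Definition qtilde (n k : nat) : R := \sum_(0 <= j < k.+1) Q n j - c n.

(* Ftilde i n is F_n^(i); the value for n < i is a junk 0. *)
Definition Ftilde (i : nat) : nat -> R :=
  course (fun n h => if n == i then 1 else
    (Q n n.+1)^-1 * \sum_(i <= k < n) qtilde n k * h`_k).

Definition dtilde : nat -> R :=
  course (fun n h => if n == 0%N then 0 else
    (Q n n.+1)^-1 * (1 + \sum_(0 <= k < n) qtilde n k * h`_k)).

Lemma Ftilde_diag (i : nat) : Ftilde i i = 1.
Proof. by rewrite /Ftilde /course eqxx. Qed.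

Lemma FtildeE (i n : nat) : (i < n)%N ->
  Ftilde i n = (Q n n.+1)^-1 * \sum_(i <= k < n) qtilde n k * Ftilde i k.
Proof.
move=> lt_in; rewrite {1}/Ftilde /course gtn_eqF //; congr (_ * _).
by apply: eq_big_nat => k /andP[_ kn]; rewrite nth_history.
Qed.

Lemma dtilde0 : dtilde 0 = 0.
Proof. by []. Qed.

Lemma dtildeE (n : nat) : (0 < n)%N ->
  dtilde n = (Q n n.+1)^-1 * (1 + \sum_(0 <= k < n) qtilde n k * dtilde k).
Proof.
move=> n0; rewrite {1}/dtilde /course gtn_eqF //; congr (_ * (_ + _)).
by apply: eq_big_nat => k /andP[_ kn]; rewrite nth_history.
Qed.

End Sequences.

(* Main.v *)
(* Let V n = E_n[exp(- lam * tau)], tau >= 0 being the hitting time of 0.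
   Conditioning on the jump chain and integrating out the exponential holding
   times one by one makes V the increasing limit of an explicit recursion, so
   V 0 = 1 and Q V = lam V off 0.  Since Q has a single birth, Q w = lam w - lam
   determines the increments of w = 1 - V recursively:
   w (n+1) - w n = F_n * w 1 - lam * d_n.  Dividing the sum of these by
   \sum_(k < n) F_k, and using 0 <= w <= 1, gives lam * dlim = w 1 as soon as
   \sum_k F_k = +oo.  If that sum were finite, its partial sums would form a
   nonzero bounded solution of Q f = lam f off 0 with f 0 = 0, which recurrence
   (0 is hit almost surely from every state) rules out. *)
Require Import Defs.
From HB Require Import structures.
From mathcomp Require Import all_boot all_order all_algebra.
From mathcomp Require Import all_classical all_reals all_analysis.
From mathcomp Require Import measurable_realfun ring lra.
Set Implicit Arguments.
Unset Strict Implicit.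
Unset Printing Implicit Defensive.
Import Order.TTheory GRing.Theory Num.Theory.
Import numFieldNormedType.Exports.
Local Open Scope classical_set_scope.
Local Open Scope ring_scope.

(** * The first-step recursion *)

(** Entries beyond [n.+1] vanish, so the partial sums in [Qconservative] are eventually constant and
    the limit is a finite sum. *)
Lemma row_sum0 (R : realType) (Q : nat -> nat -> R) :
  single_birth_Qmatrix Q -> forall n, \sum_(0 <= j < n.+2) Q n j = 0.
Proof.
move=> HQ n; transitivity (limn (fun N => \sum_(0 <= j < N) Q n j)); last first.
  exact: cvg_lim (Qconservative HQ n).
apply/esym/cvg_lim => //; apply: cvg_near_cst; near=> N.
have leN : (n.+2 <= N)%N by near: N; exact: nbhs_infty_ge.
rewrite (@big_cat_nat _ _ _ n.+2)//= [X in _ + X]big1_seq ?addr0// => j.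
rewrite mem_index_iota => /andP[_ /andP[nj _]].
by rewrite -(subnKC (ltnW (ltnW nj))) (Qskipfree HQ)// ltn_subRL addn1.
Unshelve. all: by end_near. Qed.

(** By the zero row sum, [- Q n n] is the sum of the off-diagonal entries of the row, one of which
    is the positive birth rate. *)
Lemma exit_rate_gt0 (R : realType) (Q : nat -> nat -> R) :
  single_birth_Qmatrix Q -> forall n, 0 < - Q n n.
Proof.
move=> HQ n; have /eqP := row_sum0 HQ n.
rewrite 2?big_nat_recr//= -addrA addrC -addrA addr_eq0 => /eqP ->.
rewrite opprK ltr_pwDl ?(Qbirth_gt0 HQ)//.
rewrite big_nat_cond sumr_ge0// => j /andP[/andP[_ jn] _].
by rewrite (Qoffdiag_ge0 HQ)// gtn_eqF.
Qed.

Lemma jump_prob_ge0 (R : realType) (Q : nat -> nat -> R) :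
  single_birth_Qmatrix Q -> forall n j, 0 <= jump_prob Q n j.
Proof.
move=> HQ n j; rewrite /jump_prob; case: eqVneq => // jn.
by rewrite divr_ge0 ?(Qoffdiag_ge0 HQ) 1?eq_sym// ltW// exit_rate_gt0.
Qed.

Lemma jump_prob_skipfree (R : realType) (Q : nat -> nat -> R) :
  single_birth_Qmatrix Q -> forall n j, (n.+2 <= j)%N -> jump_prob Q n j = 0.
Proof.
move=> HQ n j nj; rewrite /jump_prob gtn_eqF ?(ltn_trans _ nj)//.
by rewrite -(subnKC (ltnW (ltnW nj))) (Qskipfree HQ) ?mul0r// ltn_subRL addn1.
Qed.

(* The one-step kernel n -> j weighted by E[exp(- lam * holding time)];
   [lam = 0] gives the jump chain itself. *)
Definition discounted_jump (R : realType) (Q : nat -> nat -> R) (lam : R)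
    (n j : nat) : R :=
  jump_prob Q n j * (- Q n n / (- Q n n + lam)).

Lemma discounted_jump_ge0 (R : realType) (Q : nat -> nat -> R) (lam : R) :
  single_birth_Qmatrix Q -> 0 <= lam ->
  forall n j, 0 <= discounted_jump Q lam n j.
Proof.
move=> HQ lam0 n j; have q0 := exit_rate_gt0 HQ n.
by rewrite mulr_ge0 ?jump_prob_ge0// divr_ge0 ?addr_ge0// ltW.
Qed.

Lemma discounted_jump0 (R : realType) (Q : nat -> nat -> R) :
  single_birth_Qmatrix Q ->
  forall n j, discounted_jump Q 0 n j = jump_prob Q n j.
Proof.
move=> HQ n j; rewrite /discounted_jump addr0 divff ?mulr1//.
by rewrite gt_eqF// exit_rate_gt0.
Qed.

Lemma discounted_jump_le (R : realType) (Q : nat -> nat -> R) (lam : R) :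
  single_birth_Qmatrix Q -> 0 <= lam ->
  forall n j, discounted_jump Q lam n j <= jump_prob Q n j.
Proof.
move=> HQ lam0 n j; have q0 := exit_rate_gt0 HQ n.
rewrite -[leRHS]mulr1 ler_wpM2l ?jump_prob_ge0//.
by rewrite ler_pdivrMr ?mul1r ?lerDl// ltr_wpDr.
Qed.

(** Off the diagonal the factor [- Q n n + lam] turns [discounted_jump Q lam n j] back into [Q n j].
    Hence, at [n], being a fixed point of the kernel is the same as [Q f = lam f]. *)
Lemma discounted_jump_sum (R : realType) (Q : nat -> nat -> R) (lam : R)
    (f : nat -> R) :
  single_birth_Qmatrix Q -> 0 <= lam -> forall n,
  (- Q n n + lam) * \sum_(0 <= j < n.+2) discounted_jump Q lam n j * f j =
  \sum_(0 <= j < n.+2) Q n j * f j - Q n n * f n.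
Proof.
move=> HQ lam0 n; have q0 := exit_rate_gt0 HQ n.
have rE j : (- Q n n + lam) * discounted_jump Q lam n j =
    if j == n then 0 else Q n j.
  rewrite /discounted_jump /jump_prob; case: ifP => _; first by ring.
  set q := - Q n n in q0 *; have ql : 0 < q + lam by rewrite ltr_wpDr.
  by field; rewrite !gt_eqF.
rewrite mulr_sumr; under eq_bigr do rewrite mulrA rE.
rewrite 2?big_nat_recr//= 2?[in RHS]big_nat_recr//= eqxx gtn_eqF//.
rewrite mul0r addr0 [RHS]addrAC addrK; congr (_ + _).
by apply: eq_big_nat => j /andP[_ jn]; rewrite ltn_eqF.
Qed.

Lemma jump_prob_sum (R : realType) (Q : nat -> nat -> R) :
  single_birth_Qmatrix Q ->
  forall n, \sum_(0 <= j < n.+2) jump_prob Q n j = 1.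
Proof.
move=> HQ n; have q0 := exit_rate_gt0 HQ n.
have := discounted_jump_sum (fun=> 1) HQ (lexx 0) n.
under eq_bigr do rewrite discounted_jump0// mulr1.
under [in RHS]eq_bigr do rewrite mulr1.
rewrite (row_sum0 HQ) sub0r mulr1 addr0 => /(canRL (mulKf _)) ->.
  by rewrite mulVf// gt_eqF.
by rewrite gt_eqF.
Qed.

(* [hit_weight Q lam m n] is E_n[exp(- lam * J_m); tau = m], where tau is the
   first m >= 0 with Y_m = 0. *)
Fixpoint hit_weight (R : realType) (Q : nat -> nat -> R) (lam : R)
    (m n : nat) : R :=
  if m is m'.+1 then
    if n == 0%N then 0 else
      \sum_(0 <= j < n.+2) discounted_jump Q lam n j * hit_weight Q lam m' j
  else (n == 0%N)%:R.

Lemma hit_weight_ge0 (R : realType) (Q : nat -> nat -> R) (lam : R) :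
  single_birth_Qmatrix Q -> 0 <= lam ->
  forall m n, 0 <= hit_weight Q lam m n.
Proof.
move=> HQ lam0; elim=> [|m IH] n /=; first by rewrite ler0n.
by case: ifP => // _; rewrite sumr_ge0// => j _; rewrite mulr_ge0 ?discounted_jump_ge0.
Qed.

Definition hit_weight_sum (R : realType) (Q : nat -> nat -> R) (lam : R)
    (n N : nat) : R := \sum_(0 <= m < N) hit_weight Q lam m n.

Lemma hit_weight_sum0 (R : realType) (Q : nat -> nat -> R) (lam : R) (N : nat) :
  hit_weight_sum Q lam 0 N.+1 = 1.
Proof. by rewrite /hit_weight_sum big_nat_recl//= big1 ?addr0. Qed.

Lemma hit_weight_sumS (R : realType) (Q : nat -> nat -> R) (lam : R) (n N : nat) :
  hit_weight_sum Q lam n.+1 N.+1 =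
  \sum_(0 <= j < n.+3) discounted_jump Q lam n.+1 j * hit_weight_sum Q lam j N.
Proof.
rewrite /hit_weight_sum big_nat_recl//= add0r exchange_big/=.
by apply: eq_bigr => j _; rewrite mulr_sumr.
Qed.

(** Induction on [N] along the first-step identity: the discounted kernel is dominated by the jump
    kernel, whose rows sum to 1. *)
Lemma hit_weight_sum_le1 (R : realType) (Q : nat -> nat -> R) (lam : R) :
  single_birth_Qmatrix Q -> 0 <= lam ->
  forall N n, hit_weight_sum Q lam n N <= 1.
Proof.
move=> HQ lam0; elim=> [|N IH] [|n]; rewrite ?hit_weight_sum0 ?hit_weight_sumS//;
  try by rewrite /hit_weight_sum big_geq.
rewrite -(jump_prob_sum HQ n.+1); apply: ler_sum => j _.
rewrite -[leRHS]mulr1; apply: ler_pM => //; last exact: discounted_jump_le.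
  exact: discounted_jump_ge0.
by rewrite sumr_ge0// => m _; exact: hit_weight_ge0.
Qed.

Lemma is_cvg_hit_weight_sum (R : realType) (Q : nat -> nat -> R) (lam : R) :
  single_birth_Qmatrix Q -> 0 <= lam ->
  forall n, cvgn (hit_weight_sum Q lam n).
Proof.
move=> HQ lam0 n; apply: nondecreasing_is_cvgn.
  apply/nondecreasing_seqP => N; rewrite /hit_weight_sum big_nat_recr//=.
  by rewrite lerDl hit_weight_ge0.
by exists 1 => _ [N _ <-]; exact: hit_weight_sum_le1.
Qed.

(* E_n[exp(- lam * tau)] for the first time tau >= 0 at which X is at 0. *)
Definition hit_transform (R : realType) (Q : nat -> nat -> R) (lam : R)
    (n : nat) : R := limn (hit_weight_sum Q lam n).

Lemma hit_transform_cvg (R : realType) (Q : nat -> nat -> R) (lam : R) :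
  single_birth_Qmatrix Q -> 0 <= lam ->
  forall n, hit_weight_sum Q lam n @ \oo --> hit_transform Q lam n.
Proof. by move=> HQ lam0 n; exact: is_cvg_hit_weight_sum. Qed.

Lemma hit_transform0 (R : realType) (Q : nat -> nat -> R) (lam : R) :
  hit_transform Q lam 0 = 1.
Proof.
apply/cvg_lim => //; rewrite -cvg_shiftS.
by apply: cvg_near_cst; near=> N; rewrite /= hit_weight_sum0.
Unshelve. all: by end_near. Qed.

(** Each row has only finitely many possible targets, so the limit passes through the sum term by
    term. *)
Lemma hit_transform_first_step_cvg (R : realType) (Q : nat -> nat -> R) (lam : R) :
  single_birth_Qmatrix Q -> 0 <= lam -> forall n,
  (fun N => \sum_(0 <= j < n.+2) discounted_jump Q lam n j * hit_weight_sum Q lam j N)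
    @ \oo --> \sum_(0 <= j < n.+2) discounted_jump Q lam n j * hit_transform Q lam j.
Proof.
move=> HQ lam0 n; apply: cvg_big => [x|j _]; first exact: add_continuous.
by apply: cvgMl_tmp; exact: hit_transform_cvg.
Qed.

Lemma hit_transformS (R : realType) (Q : nat -> nat -> R) (lam : R) :
  single_birth_Qmatrix Q -> 0 <= lam -> forall n,
  hit_transform Q lam n.+1 =
  \sum_(0 <= j < n.+3) discounted_jump Q lam n.+1 j * hit_transform Q lam j.
Proof.
move=> HQ lam0 n; apply/cvg_lim => //; rewrite -cvg_shiftS.
under eq_fun do rewrite hit_weight_sumS.
exact: hit_transform_first_step_cvg.
Qed.

Lemma hit_transform_bounds (R : realType) (Q : nat -> nat -> R) (lam : R) :
  single_birth_Qmatrix Q -> 0 <= lam ->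
  forall n, 0 <= hit_transform Q lam n <= 1.
Proof.
move=> HQ lam0 n; apply/andP; split.
  apply: limr_ge; first exact: is_cvg_hit_weight_sum.
  by apply: nearW => N; rewrite sumr_ge0// => m _; exact: hit_weight_ge0.
apply: limr_le; first exact: is_cvg_hit_weight_sum.
by apply: nearW => N; exact: hit_weight_sum_le1.
Qed.

(** * Integrating out the holding times *)

Lemma measurable_fun_natr (R : realType) (d : measure_display)
    (T : measurableType d) (b : T -> bool) :
  measurable_fun setT b -> measurable_fun setT (fun w => (b w)%:R : R).
Proof.
move=> mb; rewrite (_ : (fun w => _) = fun w => if b w then 1 else 0).
  exact: measurable_fun_ifT.
by apply/funext => w; case: (b w).
Qed.

Lemma integral_exponential_pdf_lt (R : realType) (a s : R) : 0 < s ->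
  (\int[lebesgue_measure]_t (exponential_pdf a t * (t < s)%R%:R)%:E =
   (1 - expR (- a * s))%:E)%E.
Proof.
move=> s0; rewrite EFinB -exponential_prob_itv0c// /exponential_prob.
(* The strict indicator yields a half-open interval; dropping the endpoint [s] does not change the
   Lebesgue integral. *)
rewrite -integral_itv_bndo_bndc; last first.
  by apply/measurable_EFinP/measurable_funTS; exact: measurable_exponential_pdf.
rewrite [RHS]integral_mkcond; apply: eq_integral => t _.
rewrite patchE mem_setE in_itv/=.
have [t0|t0] := leP 0 t; last by rewrite lt0_exponential_pdf ?mul0r.
by case: ltP => _; rewrite ?mulr1 ?mulr0 ?t0 /=.
Qed.

(* Fubini, with 1 - exp(- lam s) = \int_0^oo lam exp(- lam t) 1_(t < s) dt. *)
Lemma integral_weighted_expR (R : realType) (d : measure_display)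
    (T : measurableType d) (P : {finite_measure set T -> \bar R})
    (W S : T -> R) (K q lam : R) :
  measurable_fun setT W -> measurable_fun setT S ->
  (forall w, 0 <= W w) -> (forall w, 0 < S w) -> 0 < q -> 0 <= lam ->
  (forall s, 0 <= s ->
     (\int[P]_w (W w * (s < S w)%R%:R)%:E = (K * expR (- q * s))%:E)%E) ->
  (\int[P]_w (W w * expR (- lam * S w))%:E = (K * (q / (q + lam)))%:E)%E.
Proof.
move=> mW mS W0 S0 q0 lam0 Wtail.
(* This is the tail hypothesis at [s = 0], where the indicator is 1 because [S] is positive. *)
have IW : (\int[P]_w (W w)%:E = K%:E)%E.
  rewrite -[K]mulr1 -expR0 -(mulr0 (- q)) -Wtail//.
  by apply: eq_integral => w _; rewrite S0 mulr1.
have K0 : 0 <= K by rewrite -lee_fin -IW integral_ge0// => w _; rewrite lee_fin.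
have [->|lam_neq0] := eqVneq lam 0.
  rewrite addr0 divff ?gt_eqF// mulr1 -IW.
  by apply: eq_integral => w _; rewrite oppr0 mul0r expR0 mulr1.
have {lam_neq0}lam_gt0 : 0 < lam by rewrite lt_def lam_neq0.
have mE : measurable_fun setT (fun w => expR (- lam * S w)).
  by apply: measurableT_comp => //; exact: measurable_funM.
have E1 w : 0 <= 1 - expR (- lam * S w).
  by rewrite subr_ge0 -expR0 ler_expR mulNr oppr_le0 mulr_ge0// ltW.
have complement : (\int[P]_w (W w * (1 - expR (- lam * S w)))%:E =
    (K * (lam / (q + lam)))%:E)%E.
  transitivity (\int[P]_w \int[lebesgue_measure]_t
      (W w * (exponential_pdf lam t * (t < S w)%R%:R))%:E)%E.
    apply: eq_integral => w _; under [RHS]eq_integral do rewrite EFinM.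
    rewrite ge0_integralZl_EFin//; last 2 first.
    - by move=> t _; rewrite lee_fin mulr_ge0// exponential_pdf_ge0.
    - apply/measurable_EFinP; apply: measurable_funM.
        exact: measurable_exponential_pdf.
      by apply: measurable_fun_natr; exact: measurable_fun_ltr.
    by rewrite integral_exponential_pdf_lt// EFinM.
  transitivity (\int[lebesgue_measure]_t \int[P]_w
      (W w * (exponential_pdf lam t * (t < S w)%R%:R))%:E)%E.
  apply: (@fubini_tonelli _ _ _ _ _ P lebesgue_measure (fun z : T * measurableTypeR R =>
    (W z.1 * (exponential_pdf lam z.2 * (z.2 < S z.1)%R%:R))%:E)).
  - apply/measurable_EFinP; apply: measurable_funM.
      exact: measurableT_comp mW measurable_fst.
    apply: measurable_funM.
      by apply: measurableT_comp => //; exact: measurable_exponential_pdf.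
    apply: measurable_fun_natr; apply: measurable_fun_ltr => //.
    exact: measurableT_comp mS measurable_fst.
  - by move=> z; rewrite lee_fin !mulr_ge0// exponential_pdf_ge0.
  (* After the swap the inner integral is a tail, and [lam * expR (- lam * t) * expR (- q * t)] is
     [lam / (q + lam)] times the exponential density of rate [q + lam], which has mass 1. *)
  transitivity (\int[lebesgue_measure]_t
      ((K * (lam / (q + lam)))%:E * (exponential_pdf (q + lam) t)%:E))%E.
    apply: eq_integral => t _.
    have [t0|t0] := leP 0 t; last first.
      rewrite !lt0_exponential_pdf// mule0; apply: integral0_eq => w _.
      by rewrite mul0r mulr0.
    under eq_integral do rewrite mulrCA EFinM.
    rewrite ge0_integralZl_EFin// ?exponential_pdf_ge0//; last 2 first.
    - by move=> w _; rewrite lee_fin mulr_ge0.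
    - apply/measurable_EFinP; apply: measurable_funM => //.
      by apply: measurable_fun_natr; exact: measurable_fun_ltr.
    rewrite Wtail// -!EFinM !exponential_pdfE//; congr (_%:E).
    have -> : - (q + lam) * t = - q * t + - lam * t by rewrite opprD mulrDl.
    rewrite expRD.
    move: (expR (- q * t)) (expR (- lam * t)) => x y; field.
    by rewrite gt_eqF// addr_gt0.
  rewrite ge0_integralZl_EFin//; last 3 first.
  - by move=> t _; rewrite lee_fin exponential_pdf_ge0// ltW// addr_gt0.
  - by apply/measurable_EFinP; exact: measurable_exponential_pdf.
  - by rewrite mulr_ge0// divr_ge0// ltW// addr_gt0.
  by rewrite integral_exponential_pdf ?addr_gt0// mule1.
have mWE : measurable_fun setT (fun w => (W w * expR (- lam * S w))%:E).
  by apply/measurable_EFinP; exact: measurable_funM.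
have : (\int[P]_w (W w * expR (- lam * S w))%:E +
        (K * (lam / (q + lam)))%:E = K%:E)%E.
  rewrite -complement -ge0_integralD//; last 3 first.
  - by move=> w _; rewrite lee_fin mulr_ge0// expR_ge0.
  - by move=> w _; rewrite lee_fin mulr_ge0.
  - apply/measurable_EFinP; apply: measurable_funM => //.
    exact: measurable_funB.
  rewrite -IW; apply: eq_integral => w _; rewrite -EFinD; congr (_%:E).
  by rewrite mulrBr mulr1 addrC subrK.
(* The complement is a finite number, so it may be cancelled in the extended reals. *)
move=> sumE; rewrite -[LHS](@addeK _ (K * (lam / (q + lam)))%:E)// sumE.
rewrite -EFinB; congr (_%:E); field.
by rewrite gt_eqF// addr_gt0.
Qed.

(** The data of [markov_chain] for a single starting state, detached from the path [X]: all
    integrals below involve only the jump chain and the holding times. *)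
Record jump_holding (R : realType) (Q : nat -> nat -> R) (d : measure_display)
    (T : measurableType d) (P : probability T R) (n : nat)
    (Y : nat -> T -> nat) (S : nat -> T -> R) : Prop := {
  jump_measurable : forall m, measurable_fun setT (Y m);
  holding_measurable : forall m, measurable_fun setT (S m);
  holding_gt0 : forall m w, 0 < S m w;
  cylinder_law : forall (m : nat) (i : nat -> nat) (s : nat -> R),
    (forall k, 0 <= s k) ->
    P [set w | forall k, (k <= m)%N -> Y k w = i k /\ s k < S k w] =
    ((i 0%N == n)%:R * (\prod_(0 <= k < m) jump_prob Q (i k) (i k.+1)) *
     \prod_(0 <= k < m.+1) expR (- (- Q (i k) (i k)) * s k))%:E }.

Lemma measurable_jump_eq (R : realType) (Q : nat -> nat -> R)
    (d : measure_display) (T : measurableType d) (P : probability T R) (n : nat)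
    (Y : nat -> T -> nat) (S : nat -> T -> R) :
  jump_holding Q P n Y S ->
  forall k j, measurable_fun setT (fun w => (Y k w == j)%:R : R).
Proof.
move=> YS k j; rewrite (_ : (fun w => _) = (fun l => (l == j)%:R) \o Y k)//.
exact: measurableT_comp (jump_measurable YS k).
Qed.

(** A cylinder indicator written as a product of 0/1 reals, so that lengthening the prefix by one
    state is multiplication by one factor. *)
Definition visits (R : realType) (T : Type) (Y : nat -> T -> nat) (m : nat)
    (i : nat -> nat) (w : T) : R := \prod_(k < m) (Y k w == i k)%:R.

Lemma measurable_visits (R : realType) (Q : nat -> nat -> R)
    (d : measure_display) (T : measurableType d) (P : probability T R) (n : nat)
    (Y : nat -> T -> nat) (S : nat -> T -> R) :
  jump_holding Q P n Y S ->
  forall m i, measurable_fun setT (visits R Y m i).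
Proof.
by move=> YS m i; apply: measurable_prod => k _; exact: (measurable_jump_eq YS).
Qed.

Lemma visits_ge0 (R : realType) (T : Type) (Y : nat -> T -> nat) (m : nat)
    (i : nat -> nat) (w : T) : 0 <= visits R Y m i w.
Proof. by apply: prodr_ge0 => k _; rewrite ler0n. Qed.

(* The holding times are integrated out one at a time: the first [r] factors
   already carry the discount, the others are still tail indicators. *)
Lemma integral_partially_discounted (R : realType) (Q : nat -> nat -> R)
    (d : measure_display) (T : measurableType d) (P : probability T R) (n : nat)
    (Y : nat -> T -> nat) (S : nat -> T -> R) (lam : R) :
  single_birth_Qmatrix Q -> jump_holding Q P n Y S -> 0 <= lam ->
  forall (m : nat) (i : nat -> nat) (r : nat) (s : nat -> R),
  (r <= m.+1)%N -> (forall k, 0 <= s k) ->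
  (\int[P]_w (visits R Y m.+1 i w * \prod_(k < m.+1)
     (if (k < r)%N then expR (- lam * S k w) else (s k < S k w)%R%:R))%:E =
   ((i 0%N == n)%:R * (\prod_(k < m) jump_prob Q (i k) (i k.+1)) *
    \prod_(k < m.+1) (if (k < r)%N then - Q (i k) (i k) / (- Q (i k) (i k) + lam)
                      else expR (- (- Q (i k) (i k)) * s k)))%:E)%E.
Proof.
move=> HQ YS lam0 m i.
have mdisc r s k : measurable_fun setT
    (fun w => if (k < r)%N then expR (- lam * S k w) else (s k < S k w)%R%:R).
  have mS := holding_measurable YS k; case: (k < r)%N.
    by apply: measurableT_comp => //; exact: measurable_funM.
  by apply: measurable_fun_natr; exact: measurable_fun_ltr.
elim=> [|r IH] s rm s0.
  (* For [r = 0] the integrand is the indicator of the cylinder [A], whose probability is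
     [cylinder_law]. *)
  pose A := [set w | forall k, (k <= m)%N -> Y k w = i k /\ s k < S k w].
  pose f w := visits R Y m.+1 i w * \prod_(k < m.+1) (s k < S k w)%R%:R.
  have mf : measurable_fun setT f.
    apply: measurable_funM; first exact: (measurable_visits YS).
    by apply: measurable_prod => k _; exact: (mdisc 0%N).
  have fE : f = \1_A.
    apply/funext => w; rewrite /f /visits -big_split/= indicE.
    have [/set_mem wA|/negP wA] := boolP (w \in A).
      apply: big1 => k _; have [|-> ->] := wA k; first by rewrite -ltnS.
      by rewrite eqxx mulr1.
    apply/eqP/prodf_eq0.
    have /existsNP[k /not_implyP[km Nk]] : ~ A w by move=> ?; apply: wA; exact/mem_set.
    have km' : (k < m.+1)%N by [].
    exists (Ordinal km') => //=; apply/eqP.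
    have [Yk|] := eqVneq (Y k w) (i k); last by rewrite mul0r.
    have [sk|] := ltP (s k) (S k w); last by rewrite mulr0.
    by case: Nk.
  (* [A] is the level set at 1 of its own indicator [f], a product of measurable factors. *)
  have mA : measurable A.
    rewrite (_ : A = f @^-1` [set 1]); last first.
      rewrite fE; apply/seteqP; split => w /=; rewrite indicE.
        by move=> wA; rewrite mem_set.
      by have [/set_mem//|_ /esym/eqP] := boolP (w \in A); rewrite oner_eq0.
    by rewrite -[X in measurable X]setTI; exact: mf.
  rewrite [LHS](_ : _ = \int[P]_w (\1_A w)%:E)%E; last first.
    by apply: eq_integral => w _; rewrite -fE.
  rewrite integral_indic// setIT; apply: etrans (cylinder_law YS m i s0) _.
  by rewrite !big_mkord.
pose r' := Ordinal rm.
pose phi k w : R := if (k < r.+1)%N then expR (- lam * S k w) else (s k < S k w)%R%:R.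
pose psi k : R := if (k < r.+1)%N then - Q (i k) (i k) / (- Q (i k) (i k) + lam)
                  else expR (- (- Q (i k) (i k)) * s k).
(* [W] gathers every factor except the one of index [r]; it plays the weight in
   [integral_weighted_expR], with [S r] as the holding time. *)
pose W w : R := visits R Y m.+1 i w * \prod_(k < m.+1 | k != r') phi k w.
pose K : R := (i 0%N == n)%:R * (\prod_(k < m) jump_prob Q (i k) (i k.+1)) *
  \prod_(k < m.+1 | k != r') psi k.
rewrite [LHS](_ : _ = \int[P]_w (W w * expR (- lam * S r w))%:E)%E; last first.
  apply: eq_integral => w _; rewrite (bigD1 r')//= ltnSn; congr (_%:E).
  by rewrite /W -mulrA; congr (_ * _); rewrite mulrC.
rewrite [X in _ = X%:E](_ : _ = K * (- Q (i r) (i r) / (- Q (i r) (i r) + lam))); last first.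
  by rewrite (bigD1 r')//= ltnSn /K -[RHS]mulrA; congr (_ * _); rewrite mulrC.
apply: integral_weighted_expR => //.
- apply: measurable_funM; first exact: (measurable_visits YS).
  rewrite (_ : (fun w => _) = (fun w => \prod_(k <- [seq k <- index_enum 'I_m.+1 | k != r']) phi k w)).
    by apply: measurable_prod => k _; exact: mdisc.
  by apply/funext => w; rewrite big_filter.
- exact: holding_measurable YS r.
- move=> w; rewrite mulr_ge0 ?visits_ge0// prodr_ge0// => k _.
  by rewrite /phi; case: ifP; rewrite ?expR_ge0 ?ler0n.
- by move=> w; exact: holding_gt0 YS _ _.
- exact: exit_rate_gt0.
(* The required tail formula at level [t] is the induction hypothesis with the threshold of index
   [r] reset to [t]. *)
move=> t t0; pose s' k := if k == r then t else s k.
have s'0 k : 0 <= s' k by rewrite /s'; case: ifP.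
have kr (k : 'I_m.+1) : k != r' -> (k < r.+1)%N = (k < r)%N.
  by move=> kr; rewrite ltnS leq_eqVlt -val_eqE/= in kr *; rewrite (negbTE kr).
transitivity (\int[P]_w (visits R Y m.+1 i w * \prod_(k < m.+1)
     (if (k < r)%N then expR (- lam * S k w) else (s' k < S k w)%R%:R))%:E)%E.
  apply: eq_integral => w _; congr (_%:E); rewrite /W -[LHS]mulrA; congr (_ * _).
  rewrite mulrC [RHS](bigD1 r')//= ltnn {1}/s' eqxx; congr (_ * _).
  apply: eq_bigr => k kr'; rewrite /phi kr// /s'.
  by rewrite -val_eqE/= in kr'; rewrite (negbTE kr').
rewrite IH//; last exact: ltnW.
congr (_%:E); rewrite /K -[RHS]mulrA; congr (_ * _).
rewrite [LHS](bigD1 r')//= ltnn {1}/s' eqxx mulrC; congr (_ * _).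
apply: eq_bigr => k kr'; rewrite /psi kr// /s'.
by rewrite -val_eqE/= in kr'; rewrite (negbTE kr').
Qed.

Definition jump_time (R : realType) (T : Type) (S : nat -> T -> R) (m : nat)
    (w : T) : R := \sum_(0 <= k < m) S k w.

Lemma integral_discounted_cylinder (R : realType) (Q : nat -> nat -> R)
    (d : measure_display) (T : measurableType d) (P : probability T R) (n : nat)
    (Y : nat -> T -> nat) (S : nat -> T -> R) (lam : R) :
  single_birth_Qmatrix Q -> jump_holding Q P n Y S -> 0 <= lam ->
  forall (m : nat) (i : nat -> nat),
  (\int[P]_w (visits R Y m.+1 i w * expR (- lam * jump_time S m w))%:E =
   ((i 0%N == n)%:R * \prod_(k < m) discounted_jump Q lam (i k) (i k.+1))%:E)%E.
Proof.
move=> HQ YS lam0 m i.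
(* Only the first [m] of the [m.+1] holding times enter [jump_time S m]; the last one keeps its tail
   indicator at threshold 0, which equals 1. *)
have := integral_partially_discounted HQ YS lam0 i (leqnSn m) (fun=> lexx 0).
under eq_integral => w _.
  rewrite big_ord_recr/= ltnn (holding_gt0 YS) mulr1.
  under eq_bigr => k _ do rewrite ltn_ord.
  rewrite -expR_sum -mulr_sumr -(big_mkord xpredT (fun k => S k w)).
  over.
move=> ->; congr (_%:E); rewrite -mulrA; congr (_ * _).
rewrite big_ord_recr/= ltnn mulr0 expR0 mulr1 -big_split/=.
by apply: eq_bigr => k _; rewrite ltn_ord.
Qed.

(** * Decomposition along the jump chain *)

Lemma nneseries_finite_support (R : realType) (u : nat -> \bar R) (n : nat) :
  (forall j, (n <= j)%N -> u j = 0%E) ->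
  (\sum_(0 <= j <oo) u j = \sum_(0 <= j < n) u j)%E.
Proof.
move=> u0; apply: lim_near_cst => //; near=> N.
have nN : (n <= N)%N by near: N; exact: nbhs_infty_ge.
rewrite (@big_cat_nat _ _ _ n)//= [X in (_ + X)%E]big1_seq ?adde0// => j.
by rewrite mem_index_iota => /andP[_ /andP[nj _]]; exact: u0.
Unshelve. all: by end_near. Qed.

(** For each [w] exactly one [j] contributes; monotone convergence exchanges the series and the
    integral. *)
Lemma integral_partition_jump (R : realType) (Q : nat -> nat -> R)
    (d : measure_display) (T : measurableType d) (P : probability T R) (n : nat)
    (Y : nat -> T -> nat) (S : nat -> T -> R) (k : nat) (g : T -> R) :
  jump_holding Q P n Y S -> measurable_fun setT g -> (forall w, 0 <= g w) ->
  (\int[P]_w (g w)%:E =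
   \sum_(0 <= j <oo) \int[P]_w ((Y k w == j)%:R * g w)%:E)%E.
Proof.
move=> YS mg g0; rewrite -integral_nneseries//; last 2 first.
- move=> j; apply/measurable_EFinP; apply: measurable_funM => //.
  exact: measurable_jump_eq YS k j.
- by move=> j w _; rewrite lee_fin mulr_ge0.
apply: eq_integral => w _; rewrite (@nneseries_finite_support _ _ (Y k w).+1).
  rewrite big_nat_recr//= eqxx mul1r big_nat_cond big1 ?add0e// => j.
  by case/andP => /andP[_ jY] _; rewrite gtn_eqF// mul0r.
by move=> j Yj; rewrite ltn_eqF// mul0r.
Qed.

(** Says that [k + m] is the first index from [k] on at which the chain is at 0; the recursion on
    [m] mirrors that of [hit_weight]. *)
Fixpoint first_hit (T : Type) (Y : nat -> T -> nat) (k m : nat) (w : T) : bool :=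
  if m is m'.+1 then (Y k w != 0%N) && first_hit Y k.+1 m' w else Y k w == 0%N.

(** The discount runs from time 0 up to the hit, and so includes the holding times before index
    [k]. *)
Definition discounted_hit (R : realType) (T : Type) (Y : nat -> T -> nat)
    (S : nat -> T -> R) (lam : R) (k m : nat) (w : T) : R :=
  (first_hit Y k m w)%:R * expR (- lam * jump_time S (k + m) w).

Lemma discounted_hit_ge0 (R : realType) (T : Type) (Y : nat -> T -> nat)
    (S : nat -> T -> R) (lam : R) (k m : nat) (w : T) :
  0 <= discounted_hit Y S lam k m w.
Proof. by rewrite mulr_ge0 ?ler0n ?expR_ge0. Qed.

Lemma measurable_discounted_hit (R : realType) (Q : nat -> nat -> R)
    (d : measure_display) (T : measurableType d) (P : probability T R) (n : nat)
    (Y : nat -> T -> nat) (S : nat -> T -> R) (lam : R) :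
  jump_holding Q P n Y S ->
  forall k m, measurable_fun setT (discounted_hit Y S lam k m).
Proof.
move=> YS k m; apply: measurable_funM; last first.
  apply: measurableT_comp => //; apply: measurable_funM => //.
  by apply: measurable_sum => j; exact: holding_measurable YS j.
elim: m k => [|m IH] k; first exact: measurable_jump_eq YS k _.
rewrite (_ : (fun w => _) =
    fun w => (1 - (Y k w == 0%N)%:R) * (first_hit Y k.+1 m w)%:R).
  apply: measurable_funM; last exact: IH.
  by apply: measurable_funB => //; exact: measurable_jump_eq YS k _.
by apply/funext => w /=; case: (Y k w == 0%N); rewrite /= ?subrr ?mul0r ?subr0 ?mul1r.
Qed.

(** Split according to the state [j] at index [k.+1]: each piece is the hypothesis for the prefix
    extended by [j], and the absence of upward jumps longer than 1 leaves finitely many [j]. *)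
Lemma integral_hit_first_step (R : realType) (Q : nat -> nat -> R)
    (d : measure_display) (T : measurableType d) (P : probability T R) (n : nat)
    (Y : nat -> T -> nat) (S : nat -> T -> R) (lam : R) (k m : nat) :
  single_birth_Qmatrix Q -> jump_holding Q P n Y S ->
  (forall i, \int[P]_w (visits R Y k.+2 i w * discounted_hit Y S lam k.+1 m w)%:E =
    ((i 0%N == n)%:R * (\prod_(l < k.+1) discounted_jump Q lam (i l) (i l.+1)) *
     hit_weight Q lam m (i k.+1))%:E)%E ->
  forall i,
  (\int[P]_w (visits R Y k.+1 i w * discounted_hit Y S lam k.+1 m w)%:E =
   ((i 0%N == n)%:R * (\prod_(l < k) discounted_jump Q lam (i l) (i l.+1)) *
    \sum_(0 <= j < (i k).+2) discounted_jump Q lam (i k) j * hit_weight Q lam m j)%:E)%E.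
Proof.
move=> HQ YS IH i.
pose extend j l := if l == k.+1 then j else i l.
have extendE j l : (l <= k)%N -> extend j l = i l.
  by move=> lk; rewrite /extend ltn_eqF.
have extendk j : extend j k.+1 = j by rewrite /extend eqxx.
rewrite (integral_partition_jump k.+1 YS); last 2 first.
- apply: measurable_funM; first exact: (measurable_visits YS).
  exact: measurable_discounted_hit YS _ _.
- by move=> w; rewrite mulr_ge0 ?visits_ge0 ?discounted_hit_ge0.
have termE j : (\int[P]_w ((Y k.+1 w == j)%:R *
      (visits R Y k.+1 i w * discounted_hit Y S lam k.+1 m w))%:E =
    ((i 0%N == n)%:R * (\prod_(l < k) discounted_jump Q lam (i l) (i l.+1)) *
     (discounted_jump Q lam (i k) j * hit_weight Q lam m j))%:E)%E.
  transitivity (\int[P]_w (visits R Y k.+2 (extend j) w *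
      discounted_hit Y S lam k.+1 m w)%:E)%E.
    apply: eq_integral => w _; congr (_%:E); rewrite mulrCA mulrA.
    rewrite [visits _ _ k.+2 _ _]/visits big_ord_recr/= extendk.
    congr (_ * _ * _); apply: eq_bigr => l _.
    by rewrite extendE// -ltnS.
  rewrite IH extendk (extendE _ 0%N)// big_ord_recr/= extendk (extendE _ k)//.
  rewrite -!mulrA; congr ((_ * (_ * _))%:E); apply: eq_bigr => l _.
  by rewrite !extendE// ltnW.
under eq_eseriesr do rewrite termE.
rewrite (@nneseries_finite_support _ _ (i k).+2).
  by rewrite sumEFin mulr_sumr.
by move=> j kj; rewrite /discounted_jump jump_prob_skipfree// !mul0r mulr0.
Qed.

(** The Markov property in cylinder form: the future enters only through the last state [i k]. The
    induction on [m] quantifies over all prefixes, since each step lengthens the prefix by one. *)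
Lemma integral_hit_after_prefix (R : realType) (Q : nat -> nat -> R)
    (d : measure_display) (T : measurableType d) (P : probability T R) (n : nat)
    (Y : nat -> T -> nat) (S : nat -> T -> R) (lam : R) :
  single_birth_Qmatrix Q -> jump_holding Q P n Y S -> 0 <= lam ->
  forall m k i,
  (\int[P]_w (visits R Y k.+1 i w * discounted_hit Y S lam k m w)%:E =
   ((i 0%N == n)%:R * (\prod_(l < k) discounted_jump Q lam (i l) (i l.+1)) *
    hit_weight Q lam m (i k))%:E)%E.
Proof.
move=> HQ YS lam0; elim=> [|m IH] k i.
  transitivity (\int[P]_w ((i k == 0%N)%:R%:E *
      (visits R Y k.+1 i w * expR (- lam * jump_time S k w))%:E))%E.
    apply: eq_integral => w _; rewrite -EFinM /discounted_hit addn0/=.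
    congr (_%:E); rewrite /visits big_ord_recr/=.
    have [->|_] := eqVneq (Y k w) (i k); last by rewrite !(mulr0, mul0r).
    by rewrite !mulr1 mulrCA.
  rewrite ge0_integralZl_EFin//; last 2 first.
  - by move=> w _; rewrite lee_fin mulr_ge0 ?visits_ge0 ?expR_ge0.
  - apply/measurable_EFinP/measurable_funM; first exact: (measurable_visits YS).
    apply: measurableT_comp => //; apply: measurable_funM => //.
    by apply: measurable_sum => j; exact: holding_measurable YS j.
  by rewrite (integral_discounted_cylinder HQ YS)// -EFinM mulrC.
(* If the prefix already ends at 0, the first hit cannot come [m.+1] jumps later, and both sides
   vanish. *)
have [ik0|ik0] := eqVneq (i k) 0%N.
  rewrite /= ik0 eqxx mulr0; apply: integral0_eq => w _.
  rewrite /visits /discounted_hit big_ord_recr/= ik0.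
  by case: (Y k w == 0%N); rewrite ?(mulr0, mul0r).
rewrite /= (negbTE ik0) -(integral_hit_first_step HQ YS (IH k.+1)).
apply: eq_integral => w _; rewrite /discounted_hit addSnnS/=; congr (_%:E).
rewrite /visits big_ord_recr/=.
have [->|_] := eqVneq (Y k w) (i k); last by rewrite !(mulr0, mul0r).
by rewrite ik0.
Qed.

(** Hits are counted from index 1 because a return comes after the first jump. Hence one
    unconditional step precedes the hitting weights, even when [n] is 0. *)
Lemma integral_discounted_return (R : realType) (Q : nat -> nat -> R)
    (d : measure_display) (T : measurableType d) (P : probability T R) (n : nat)
    (Y : nat -> T -> nat) (S : nat -> T -> R) (lam : R) :
  single_birth_Qmatrix Q -> jump_holding Q P n Y S -> 0 <= lam ->
  forall m, (\int[P]_w (discounted_hit Y S lam 1 m w)%:E =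
   (\sum_(0 <= j < n.+2) discounted_jump Q lam n j * hit_weight Q lam m j)%:E)%E.
Proof.
move=> HQ YS lam0 m; rewrite (integral_partition_jump 0 YS); last 2 first.
- exact: measurable_discounted_hit YS _ _.
- by move=> w; exact: discounted_hit_ge0.
have termE j : (\int[P]_w ((Y 0%N w == j)%:R * discounted_hit Y S lam 1 m w)%:E =
    ((j == n)%:R * \sum_(0 <= l < j.+2) discounted_jump Q lam j l * hit_weight Q lam m l)%:E)%E.
  (* The prefix has length one, so only the value [j] at index 0 of the constant sequence
     matters. *)
  have := integral_hit_first_step HQ YS (integral_hit_after_prefix HQ YS lam0 m 1) (fun=> j).
  rewrite big_ord0 mulr1 => <-.
  by apply: eq_integral => w _; rewrite /visits big_ord_recr big_ord0/= mul1r.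
under eq_eseriesr do rewrite termE.
rewrite (@nneseries_finite_support _ _ n.+1) => [|j nj]; last first.
  by rewrite gtn_eqF// mul0r.
rewrite big_nat_recr//= eqxx mul1r big_nat_cond big1 ?add0e// => j.
by case/andP => /andP[_ jn] _; rewrite ltn_eqF// mul0r.
Qed.

Lemma laplace_return_series (R : realType) (Q : nat -> nat -> R)
    (d : measure_display) (T : measurableType d) (P : probability T R) (n : nat)
    (Y : nat -> T -> nat) (S : nat -> T -> R) (lam : R) :
  single_birth_Qmatrix Q -> jump_holding Q P n Y S -> 0 <= lam ->
  (\int[P]_w \sum_(0 <= m <oo) (discounted_hit Y S lam 1 m w)%:E =
   (\sum_(0 <= j < n.+2) discounted_jump Q lam n j * hit_transform Q lam j)%:E)%E.
Proof.
move=> HQ YS lam0; rewrite integral_nneseries//; last 2 first.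
- by move=> m; apply/measurable_EFinP; exact: measurable_discounted_hit YS _ _.
- by move=> m w _; rewrite lee_fin discounted_hit_ge0.
under eq_eseriesr do rewrite (integral_discounted_return HQ YS)//.
apply/cvg_lim => //.
under eq_fun do rewrite sumEFin exchange_big/=.
apply: cvg_EFin; first exact: nearW.
rewrite /comp/=.
under eq_fun do under eq_bigr do rewrite -mulr_sumr.
exact: hit_transform_first_step_cvg.
Qed.

(** * The return time on a path *)

Lemma ereal_inf_min (R : realType) (A : set R) (x : R) :
  A x -> (forall y, A y -> x <= y) -> ereal_inf [set y%:E | y in A] = x%:E.
Proof.
move=> Ax xA; apply/eqP; rewrite eq_le; apply/andP; split.
  by apply: ereal_inf_lbound; exists x.
by apply: le_ereal_inf_tmp => _ [y Ay <-]; rewrite lee_fin xA.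
Qed.

Lemma first_hitP (T : Type) (Y : nat -> T -> nat) (k m : nat) (w : T) :
  first_hit Y k m w <->
  Y (k + m)%N w = 0%N /\ (forall l, (l < m)%N -> Y (k + l)%N w <> 0%N).
Proof.
elim: m k => [|m IH] k /=.
  by rewrite addn0; split=> [/eqP //|[-> _]].
split=> [/andP[/eqP Yk /IH[Ym Yl]]|[Ym Yl]].
  split=> [|[|l]]; first by rewrite -addSnnS.
    by rewrite addn0.
  by rewrite ltnS -addSnnS; exact: Yl.
apply/andP; split; first by apply/eqP; have := Yl 0%N isT; rewrite addn0.
apply/IH; split; first by rewrite addSnnS.
by move=> l lm; rewrite addSnnS; exact: Yl.
Qed.

Lemma jump_timeS (R : realType) (T : Type) (S : nat -> T -> R) (m : nat) (w : T) :
  jump_time S m.+1 w = jump_time S m w + S m w.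
Proof. by rewrite /jump_time big_nat_recr. Qed.

Lemma le_jump_time (R : realType) (T : Type) (S : nat -> T -> R) (w : T) :
  (forall m, 0 < S m w) -> {homo (fun m => jump_time S m w) : m p / (m <= p)%N >-> m <= p}.
Proof.
by move=> S0; apply: homo_leq => [//|y x z|m]; [exact: le_trans|rewrite jump_timeS lerDl ltW].
Qed.

(** Unless [t] is beyond all jump times, the least index whose jump time exceeds [t] is a successor
    [m.+1], and [m] is the current step. *)
Lemma step_path_locate (R : realType) (T : Type) (X : R -> T -> option nat)
    (Y : nat -> T -> nat) (S : nat -> T -> R) (w : T) (t : R) :
  step_path X Y S w -> 0 <= t ->
  X t w = None \/
  exists m, jump_time S m w <= t < jump_time S m.+1 w /\ X t w = Some (Y m w).
Proof.
move=> [S0 _ XY Xoo] t0.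
have [tJ|/existsNP[p0 /negP]] := pselect (forall m, jump_time S m w <= t).
  by left; exact: Xoo.
rewrite -ltNge => tJ; right.
have ex : exists m, t < jump_time S m w by exists p0.
case: (ex_minnP ex) => -[|m]; first by rewrite /jump_time big_geq// ltNge t0.
move=> tm min_m; exists m; have mt : jump_time S m w <= t < jump_time S m.+1 w.
  by rewrite tm andbT leNgt; apply/negP => /min_m; rewrite ltnn.
by split=> //; exact: XY.
Qed.

Lemma step_path_jump (R : realType) (T : Type) (X : R -> T -> option nat)
    (Y : nat -> T -> nat) (S : nat -> T -> R) (w : T) (m : nat) :
  step_path X Y S w -> X (jump_time S m w) w = Some (Y m w).
Proof.
by move=> [S0 _ XY _]; apply: XY; rewrite lexx -/(jump_time S m.+1 w) jump_timeS ltrDl S0.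
Qed.

Lemma jump_time_ge0 (R : realType) (T : Type) (S : nat -> T -> R) (w : T) :
  (forall m, 0 < S m w) -> forall m, 0 <= jump_time S m w.
Proof. by move=> S0 m; rewrite /jump_time sumr_ge0// => k _; exact: ltW. Qed.

Lemma first_jumpE (R : realType) (T : Type) (X : R -> T -> option nat)
    (Y : nat -> T -> nat) (S : nat -> T -> R) (w : T) :
  step_path X Y S w -> first_jump X w = (jump_time S 1 w)%:E.
Proof.
move=> XS; have [S0 Yne XY _] := XS; have J0 := jump_time_ge0 S0.
have X0 : X 0 w = Some (Y 0%N w).
  by rewrite -(step_path_jump 0 XS) /jump_time big_geq.
apply: ereal_inf_min; first by split=> //; rewrite X0 (step_path_jump 1 XS) => -[/Yne].
move=> t [t0]; rewrite X0 => Xt; rewrite leNgt; apply/negP => tJ.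
by apply: Xt; apply: XY; rewrite big_geq// t0.
Qed.

Lemma step_path_visit (R : realType) (T : Type) (X : R -> T -> option nat)
    (Y : nat -> T -> nat) (S : nat -> T -> R) (w : T) (t : R) (i : nat) :
  step_path X Y S w -> 0 <= t -> jump_time S 1 w <= t -> X t w = Some i ->
  exists2 p, Y p.+1 w = i & jump_time S p.+1 w <= t.
Proof.
move=> XS t0 Jt Xt; have [|[[|p] [/andP[pt tp]]]] := step_path_locate XS t0.
- by rewrite Xt.
- by rewrite ltNge Jt in tp.
- by rewrite Xt => -[->]; exists p.
Qed.

(** The infimum is attained: any other visit to 0 after the first jump belongs to a step of index at
    least [m.+1], and jump times increase. *)
Lemma return_time_first_hit (R : realType) (T : Type) (X : R -> T -> option nat)
    (Y : nat -> T -> nat) (S : nat -> T -> R) (w : T) (m : nat) :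
  step_path X Y S w -> first_hit Y 1 m w ->
  return_time X 0 w = (jump_time S m.+1 w)%:E.
Proof.
move=> XS /first_hitP[Ym Yl]; have [S0 _ _ _] := XS.
have leJ := le_jump_time S0.
apply: ereal_inf_min.
  split; first exact: jump_time_ge0.
    by rewrite (first_jumpE XS) lee_fin leJ.
  by rewrite (step_path_jump _ XS) -add1n Ym.
move=> t [t0]; rewrite (first_jumpE XS) lee_fin => Jt Xt.
have [p Yp Jp] := step_path_visit XS t0 Jt Xt.
rewrite (le_trans _ Jp)// leJ// ltnS leqNgt; apply/negP => /Yl.
by rewrite add1n.
Qed.

(** A visit to 0 after the first jump would produce a least positive index with state 0, that is, a
    first hit; so the infimum is over the empty set. *)
Lemma return_time_no_hit (R : realType) (T : Type) (X : R -> T -> option nat)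
    (Y : nat -> T -> nat) (S : nat -> T -> R) (w : T) :
  step_path X Y S w -> (forall m, ~~ first_hit Y 1 m w) ->
  return_time X 0 w = +oo%E.
Proof.
move=> XS nohit; rewrite /return_time (_ : [set t | _] = set0).
  by rewrite image_set0 ereal_inf0.
apply/seteqP; split => // t [t0]; rewrite (first_jumpE XS) lee_fin => Jt Xt.
have [p Yp _] := step_path_visit XS t0 Jt Xt.
have ex : exists p, Y p.+1 w == 0%N by exists p; exact/eqP.
case: (ex_minnP ex) => m /eqP Ym min_m; apply: (negP (nohit m)).
apply/first_hitP; split; first by rewrite add1n.
by move=> l lm; rewrite add1n => /eqP/min_m; rewrite leqNgt lm.
Qed.

(** * Laplace transform and finiteness of the return time *)

Lemma discounted_hit_series (R : realType) (T : Type) (Y : nat -> T -> nat)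
    (S : nat -> T -> R) (lam : R) (w : T) (m : nat) :
  first_hit Y 1 m w ->
  (\sum_(0 <= p <oo) (discounted_hit Y S lam 1 p w)%:E =
   (expR (- lam * jump_time S m.+1 w))%:E)%E.
Proof.
move=> hit_m; have /first_hitP[Ym Yl] := hit_m.
have other p : p != m -> discounted_hit Y S lam 1 p w = 0.
  move=> pm; rewrite /discounted_hit; case: (boolP (first_hit _ _ _ _)) => [|_]; last first.
    by rewrite mul0r.
  move=> /first_hitP[Yp Ylp]; case: (ltngtP p m) pm => // [/Yl|/Ylp] //.
rewrite (@nneseries_finite_support _ _ m.+1) => [|p mp]; last first.
  by rewrite other// gtn_eqF.
rewrite big_nat_recr//= big_nat_cond big1 ?add0e => [|p /andP[/andP[_ pm] _]].
  by rewrite /discounted_hit hit_m mul1r add1n.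
by rewrite other// ltn_eqF.
Qed.

Lemma discounted_hit_series0 (R : realType) (T : Type) (Y : nat -> T -> nat)
    (S : nat -> T -> R) (lam : R) (w : T) :
  (forall m, ~~ first_hit Y 1 m w) ->
  (\sum_(0 <= p <oo) (discounted_hit Y S lam 1 p w)%:E = 0)%E.
Proof.
move=> nohit; apply: eseries0 => p _ _.
by rewrite /discounted_hit (negbTE (nohit p)) mul0r.
Qed.

Lemma laplace_return_time (R : realType) (Q : nat -> nat -> R)
    (d : measure_display) (T : measurableType d) (P : probability T R) (n : nat)
    (X : R -> T -> option nat) (Y : nat -> T -> nat) (S : nat -> T -> R) (lam : R) :
  single_birth_Qmatrix Q -> jump_holding Q P n Y S ->
  (forall w, step_path X Y S w) -> 0 < lam ->
  laplace P (return_time X 0) lam =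
  (\sum_(0 <= j < n.+2) discounted_jump Q lam n j * hit_transform Q lam j)%:E.
Proof.
move=> HQ YS XS lam0; rewrite -(laplace_return_series HQ YS (ltW lam0)).
apply: eq_integral => w _.
have [[m hit_m]|nohit] := pselect (exists m, first_hit Y 1 m w).
  rewrite (return_time_first_hit (XS w) hit_m) (discounted_hit_series _ _ hit_m).
  by rewrite -EFinM -EFinN/= mulNr.
have {}nohit m : ~~ first_hit Y 1 m w by apply/negP => hit; apply: nohit; exists m.
rewrite (return_time_no_hit (XS w) nohit) discounted_hit_series0//.
(* Here [lam > 0] gives [lam * +oo = +oo], so the integrand is 0, like the series. *)
by rewrite gt0_muley ?lte_fin.
Qed.

(** At [lam = 0] the series of discounted hits is the indicator of a finite return time. It is
    treated apart from [laplace], whose integrand at [lam = 0] is 1 even on infinite return times,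
    as [0 * +oo = 0]. *)
Lemma prob_return_time (R : realType) (Q : nat -> nat -> R)
    (d : measure_display) (T : measurableType d) (P : probability T R) (n : nat)
    (X : R -> T -> option nat) (Y : nat -> T -> nat) (S : nat -> T -> R) :
  single_birth_Qmatrix Q -> jump_holding Q P n Y S ->
  (forall w, step_path X Y S w) ->
  P [set w | (return_time X 0 w < +oo)%E] =
  (\sum_(0 <= j < n.+2) jump_prob Q n j * hit_transform Q 0 j)%:E.
Proof.
move=> HQ YS XS; pose A := [set w | (return_time X 0 w < +oo)%E].
pose h w := (\sum_(0 <= p <oo) (discounted_hit Y S 0 1 p w)%:E)%E.
have hE : h = EFin \o \1_A.
  apply/funext => w; rewrite /h /= indicE.
  have [[m hit_m]|nohit] := pselect (exists m, first_hit Y 1 m w).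
    rewrite (discounted_hit_series _ _ hit_m) oppr0 mul0r expR0 mem_set//.
    by rewrite /A/= (return_time_first_hit (XS w) hit_m) ltry.
  have {}nohit m : ~~ first_hit Y 1 m w by apply/negP => hit; apply: nohit; exists m.
  rewrite discounted_hit_series0// memNset//.
  by rewrite /A/= (return_time_no_hit (XS w) nohit) ltxx.
have mh : measurable_fun setT h.
  apply: ge0_emeasurable_sum => [p w _ _|p _].
    by rewrite lee_fin discounted_hit_ge0.
  by apply/measurable_EFinP; exact: measurable_discounted_hit YS _ _.
have mA : measurable A.
  rewrite (_ : A = h @^-1` [set 1%E]); last first.
    rewrite hE; apply/seteqP; split => w /=; rewrite indicE.
      by move=> wA; rewrite mem_set.
    by have [/set_mem//|_ [/esym/eqP]] := boolP (w \in A); rewrite oner_eq0.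
  by rewrite -[X in measurable X]setTI; exact: mh.
under eq_bigr do rewrite -discounted_jump0//.
rewrite -(laplace_return_series HQ YS (lexx 0)) -[X in P X]setIT -integral_indic//.
by apply: eq_integral => w _; rewrite -/(h w) hE.
Qed.

(** * Bounded solutions and the sequences F and d *)

(** Abel summation: the coefficient of [g k] collects the [a j] with [k < j]. *)
Lemma sum_mul_partial_sums (R : comPzRingType) (a g : nat -> R) (N : nat) :
  \sum_(0 <= j < N.+1) a j * \sum_(0 <= k < j) g k =
  \sum_(0 <= k < N)
    g k * (\sum_(0 <= j < N.+1) a j - \sum_(0 <= j < k.+1) a j).
Proof.
elim: N => [|N IH]; first by rewrite big_nat1 !big_geq// mulr0.
rewrite big_nat_recr//= IH [RHS]big_nat_recr//=.
rewrite [\sum_(0 <= j < N.+2) a j]big_nat_recr//= [\sum_(0 <= k < N.+1) g k]big_nat_recr//=.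
rewrite mulrDr addrA mulr_sumr -big_split/=; congr (_ + _); last by ring.
by apply: eq_bigr => k _; ring.
Qed.

(** Applies [Q] to the partial sums of [g]. Since rows sum to 0, the tail of row [n] beyond [k] is
    minus its head, that is, [lam - qtilde n k]; the tail beyond [n] is the birth rate. *)
Lemma generator_partial_sums (R : realType) (Q : nat -> nat -> R) (lam : R)
    (g : nat -> R) (n : nat) : single_birth_Qmatrix Q ->
  \sum_(0 <= j < n.+2) Q n j * \sum_(0 <= k < j) g k =
  Q n n.+1 * g n - \sum_(0 <= k < n) qtilde Q (fun=> - lam) n k * g k
  + lam * \sum_(0 <= k < n) g k.
Proof.
move=> HQ; rewrite sum_mul_partial_sums big_nat_recr//= row_sum0//.
have -> : \sum_(0 <= j < n.+1) Q n j = - Q n n.+1.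
  by apply/eqP; rewrite -addr_eq0 -big_nat_recr//= row_sum0.
rewrite [LHS]addrC sub0r opprK [g n * _]mulrC -addrA; congr (_ + _).
rewrite -sumrN mulr_sumr -big_split/=; apply: eq_bigr => k _.
by rewrite /qtilde; ring.
Qed.

(** For [k < n] the partial row sum stops left of the diagonal, so it is nonnegative, and [lam] is
    added to it. *)
Lemma qtilde_gt0 (R : realType) (Q : nat -> nat -> R) (lam : R) :
  single_birth_Qmatrix Q -> 0 < lam ->
  forall n k, (k < n)%N -> 0 < qtilde Q (fun=> - lam) n k.
Proof.
move=> HQ lam0 n k kn; rewrite /qtilde opprK ltr_wpDl//.
rewrite big_nat_cond sumr_ge0// => j /andP[/andP[_ jk] _].
by rewrite (Qoffdiag_ge0 HQ)// gtn_eqF// (leq_ltn_trans _ kn).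
Qed.

Lemma Ftilde0_gt0 (R : realType) (Q : nat -> nat -> R) (lam : R) :
  single_birth_Qmatrix Q -> 0 < lam ->
  forall n, 0 < Ftilde Q (fun=> - lam) 0 n.
Proof.
move=> HQ lam0; elim/ltn_ind => -[_|n IH]; first by rewrite Ftilde_diag.
rewrite FtildeE// mulr_gt0 ?invr_gt0 ?(Qbirth_gt0 HQ)//.
rewrite big_nat_recl//= ltr_wpDr ?mulr_gt0 ?qtilde_gt0 ?IH//.
rewrite big_nat_cond sumr_ge0// => k /andP[/andP[_ kn] _].
by rewrite ltW// mulr_gt0 ?qtilde_gt0 ?IH.
Qed.

(** The recursion is linear and determined by [g 0]: [Ftilde] solves the homogeneous one with
    initial value 1, and [- c * dtilde] is the particular solution starting at 0. *)
Lemma tilde_recursion_unique (R : realType) (Q : nat -> nat -> R) (lam c : R)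
    (g : nat -> R) : single_birth_Qmatrix Q ->
  (forall n, (0 < n)%N ->
     Q n n.+1 * g n = \sum_(0 <= k < n) qtilde Q (fun=> - lam) n k * g k - c) ->
  forall n, g n =
    Ftilde Q (fun=> - lam) 0 n * g 0%N - c * dtilde Q (fun=> - lam) n.
Proof.
move=> HQ rec; elim/ltn_ind => -[_|n IH].
  by rewrite Ftilde_diag dtilde0 mul1r mulr0 subr0.
have q0 : Q n.+1 n.+2 != 0 by rewrite gt_eqF ?(Qbirth_gt0 HQ).
apply: (mulfI q0); rewrite rec// FtildeE// dtildeE//.
rewrite mulrBr !mulrA divff// mul1r [Q _ _ * c]mulrC -!mulrA mulVKf//.
rewrite mulrDr mulr1 opprD addrCA addrC; congr (_ - c).
rewrite mulr_suml mulr_sumr -sumrB; apply: eq_big_nat => k /andP[_ kn].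
by rewrite IH//; ring.
Qed.

(* A bounded solution of Q f = lam f off 0 with f 0 = 0 is dominated by
   C * P_n(0 is not hit within N jumps), which tends to 0. *)
Lemma bounded_solution_eq0 (R : realType) (Q : nat -> nat -> R) (lam : R)
    (f : nat -> R) (C : R) :
  single_birth_Qmatrix Q -> 0 <= lam ->
  (forall n, hit_transform Q 0 n = 1) ->
  f 0%N = 0 -> (forall n, `|f n| <= C) ->
  (forall n, (0 < n)%N -> \sum_(0 <= j < n.+2) Q n j * f j = lam * f n) ->
  forall n, f n = 0.
Proof.
move=> HQ lam0 hit1 f0 fC Qf n.
have C0 : 0 <= C by apply: le_trans (fC 0%N); rewrite normr_ge0.
have fE k : f k.+1 =
    \sum_(0 <= j < k.+3) discounted_jump Q lam k.+1 j * f j.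
  have q0 : - Q k.+1 k.+1 + lam != 0.
    by rewrite gt_eqF// ltr_wpDr// exit_rate_gt0.
  apply: (mulfI q0); rewrite (discounted_jump_sum _ HQ lam0) Qf//.
  by rewrite mulrDl mulNr addrC.
(* One step of the recursion: [discounted_jump] is at most [jump_prob], and the 1 in the bound is
   spread over the row by [jump_prob_sum]. *)
have bound N k : `|f k| <= C * (1 - hit_weight_sum Q 0 k N).
  elim: N k => [|N IH] [|k].
  - by rewrite /hit_weight_sum big_geq// subr0 mulr1.
  - by rewrite /hit_weight_sum big_geq// subr0 mulr1.
  - by rewrite hit_weight_sum0 subrr mulr0 f0 normr0.
  rewrite fE hit_weight_sumS (le_trans (ler_norm_sum _ _ _))//.
  rewrite -[X in X - _](jump_prob_sum HQ k.+1) -sumrB mulr_sumr.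
  apply: ler_sum => j _; rewrite discounted_jump0// normrM.
  rewrite (ger0_norm (discounted_jump_ge0 _ _ _ _))//.
  rewrite -[X in X - _]mulr1 -mulrBr mulrCA; apply: ler_pM => //.
    exact: discounted_jump_ge0.
  exact: discounted_jump_le.
have cvg0 : (fun N => C * (1 - hit_weight_sum Q 0 n N)) @ \oo -->
    C * (1 - hit_transform Q 0 n).
  by apply: cvgMl_tmp; apply: cvgB; [exact: cvg_cst|exact: hit_transform_cvg].
rewrite hit1 subrr mulr0 in cvg0.
apply/eqP; rewrite -normr_le0 -(cvg_lim _ cvg0)//.
apply: limr_ge; first by apply/cvg_ex; exists 0.
by apply: nearW => N; exact: bound.
Qed.

(** Certainty of hitting 0 spreads upwards: the defects [1 - hit_transform Q 0 j] average to 0 over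
    row [n], those with [j <= n] vanish by induction, and the remaining one has the positive weight
    of the birth. *)
Lemma hit_transform_recurrent (R : realType) (Q : nat -> nat -> R) :
  single_birth_Qmatrix Q ->
  \sum_(0 <= j < 2) jump_prob Q 0 j * hit_transform Q 0 j = 1 ->
  forall n, hit_transform Q 0 n = 1.
Proof.
move=> HQ rec; have pos k : 0 < jump_prob Q k k.+1.
  by rewrite /jump_prob gtn_eqF// divr_gt0 ?exit_rate_gt0 ?(Qbirth_gt0 HQ).
elim/ltn_ind => -[_|n IH]; first exact: hit_transform0.
(* At 0 this is the recurrence hypothesis; elsewhere it is the first-step equation together with the
   induction hypothesis at [n] itself. *)
have hitE : \sum_(0 <= j < n.+2) jump_prob Q n j * hit_transform Q 0 j = 1.
  case: n IH => [//|n] IH; rewrite -[RHS](IH n.+1)// hit_transformS//.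
  by apply: eq_bigr => j _; rewrite discounted_jump0.
have : \sum_(0 <= j < n.+2) jump_prob Q n j * (1 - hit_transform Q 0 j) = 0.
  under eq_bigr do rewrite mulrBr mulr1.
  by rewrite sumrB jump_prob_sum// hitE subrr.
rewrite big_nat_recr//= big_nat_cond big1 ?add0r => [/eqP|j /andP[/andP[_ jn] _]].
  by rewrite mulf_eq0 gt_eqF//= subr_eq0 => /eqP.
by rewrite IH// subrr mulr0.
Qed.

Lemma sum_Ftilde_cvgy (R : realType) (Q : nat -> nat -> R) (lam : R) :
  single_birth_Qmatrix Q -> 0 < lam -> (forall n, hit_transform Q 0 n = 1) ->
  (fun n => \sum_(0 <= k < n) Ftilde Q (fun=> - lam) 0 k) @ \oo --> +oo.
Proof.
move=> HQ lam0 hit1; pose F := Ftilde Q (fun=> - lam) 0.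
pose f n := \sum_(0 <= k < n) F k.
have F0 n : 0 < F n by exact: Ftilde0_gt0.
have nd : nondecreasing_seq f.
  by apply/nondecreasing_seqP => n; rewrite /f big_nat_recr//= lerDl ltW.
have f_ge0 n : 0 <= f n by rewrite /f sumr_ge0// => k _; exact: ltW.
apply: nondecreasing_dvgn_lt => //; apply: contrapT => /contrapT f_cvg.
have fb n : `|f n| <= limn f.
  by rewrite ger0_norm//; exact: nondecreasing_cvgn_le.
have : f 1%N = 0.
  apply: (bounded_solution_eq0 HQ (ltW lam0) hit1 _ fb); first by rewrite /f big_geq.
  (* The recursion of [Ftilde] cancels all but the term [lam * f n]. *)
  move=> n n0; rewrite (generator_partial_sums lam)//.
  by rewrite /F FtildeE// mulVKf ?subrr ?add0r// gt_eqF// (Qbirth_gt0 HQ).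
by apply/eqP; rewrite /f big_nat1 /F Ftilde_diag oner_eq0.
Qed.

(** * The limit of the ratio and the explicit transform *)

Lemma stolz_cesaro (R : realType) (u v : nat -> R) (l : R) :
  (forall n, 0 < v n) ->
  (fun n => \sum_(0 <= k < n) v k) @ \oo --> +oo ->
  (fun n => u n / v n) @ \oo --> l ->
  (fun n => (\sum_(0 <= k < n) u k) / (\sum_(0 <= k < n) v k)) @ \oo --> l.
Proof.
move=> v0 Vy uv; apply/cvgrPdist_le => e e0.
have e20 : 0 < e / 2 by rewrite divr_gt0.
have [N _ hN] : \forall n \near \oo, `|l - u n / v n| <= e / 2.
  by move/cvgrPdist_le: uv; exact.
pose C := \sum_(0 <= k < N) `|l * v k - u k|.
have C0 : 0 <= C by rewrite sumr_ge0.
near=> n; have nN : (N <= n)%N by near: n; exact: nbhs_infty_ge.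
(* Past this threshold half of [e] times the denominator absorbs the head [C]; the summand 1 keeps
   the denominator positive. *)
have Vn : 1 + 2 * C / e <= \sum_(0 <= k < n) v k.
  by near: n; move/cvgryPge : Vy; exact.
have V0 : 0 < \sum_(0 <= k < n) v k.
  by rewrite (lt_le_trans _ Vn)// ltr_pwDl// divr_ge0 ?mulr_ge0// ltW.
rewrite -[l](mulfK (lt0r_neq0 V0)) -mulrBl normrM normfV (gtr0_norm V0).
rewrite ler_pdivrMr// mulr_sumr -sumrB (le_trans (ler_norm_sum _ _ _))//.
rewrite (@big_cat_nat _ _ _ N)//=.
have tail : \sum_(N <= k < n) `|l * v k - u k| <= e / 2 * \sum_(0 <= k < n) v k.
  rewrite mulr_sumr (@big_cat_nat _ _ _ N 0)//= ler_wpDl//.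
    by rewrite sumr_ge0// => k _; rewrite mulr_ge0// ltW.
  apply: ler_sum_nat => k /andP[Nk _].
  have -> : l * v k - u k = (l - u k / v k) * v k.
    by rewrite mulrBl divfK// gt_eqF.
  by rewrite normrM (gtr0_norm (v0 k)) ler_pM2r//; exact: hN.
have head : C <= e / 2 * \sum_(0 <= k < n) v k.
  apply: le_trans (_ : e / 2 * (1 + 2 * C / e) <= _); last by rewrite ler_pM2l.
  have -> : e / 2 * (1 + 2 * C / e) = e / 2 + C by field; rewrite gt_eqF.
  by rewrite lerDr ltW.
by rewrite [e in leRHS]splitr mulrDl lerD.
Unshelve. all: by end_near. Qed.

Lemma hit_transform_tilde (R : realType) (Q : nat -> nat -> R) (lam : R) :
  single_birth_Qmatrix Q -> 0 <= lam -> forall n,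
  1 - hit_transform Q lam n =
  \sum_(0 <= k < n) (Ftilde Q (fun=> - lam) 0 k * (1 - hit_transform Q lam 1) -
                     lam * dtilde Q (fun=> - lam) k).
Proof.
move=> HQ lam0; pose V := hit_transform Q lam; pose w n := 1 - V n.
pose g k := w k.+1 - w k.
have w0 : w 0%N = 0 by rewrite /w /V hit_transform0 subrr.
have wE n : \sum_(0 <= k < n) g k = w n by rewrite telescope_sumr// w0 subr0.
have gE : forall n, g n =
    Ftilde Q (fun=> - lam) 0 n * g 0%N - lam * dtilde Q (fun=> - lam) n.
  (* Off 0, [Q V = lam V] and zero row sums give [Q w = lam w - lam]; the constant of the recursion
     is therefore [lam]. *)
  apply: tilde_recursion_unique => // -[//|n] _.
  have QV : \sum_(0 <= j < n.+3) Q n.+1 j * V j = lam * V n.+1.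
    have := discounted_jump_sum V HQ lam0 n.+1; rewrite -hit_transformS//.
    by rewrite -/V => /eqP; rewrite eq_sym subr_eq => /eqP ->; ring.
  have := generator_partial_sums lam g n.+1 HQ.
  under eq_bigr do rewrite wE mulrBr mulr1.
  rewrite sumrB row_sum0// QV wE /w => E.
  by lra.
move=> n; rewrite -/V -/(w n) -wE; apply: eq_bigr => k _.
by rewrite gE /g w0 subr0.
Qed.

(** Dividing [hit_transform_tilde] by [lam] times the sum of [Ftilde] shows that the error is
    [1 - hit_transform Q lam n], which lies in [0, 1], over a quantity tending to infinity. *)
Lemma tilde_ratio_cvg (R : realType) (Q : nat -> nat -> R) (lam : R) :
  single_birth_Qmatrix Q -> 0 < lam -> (forall n, hit_transform Q 0 n = 1) ->
  (fun n => (\sum_(0 <= k < n) dtilde Q (fun=> - lam) k) /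
            (\sum_(0 <= k < n) Ftilde Q (fun=> - lam) 0 k)) @ \oo -->
  (1 - hit_transform Q lam 1) / lam.
Proof.
move=> HQ lam0 hit1; apply/cvgrPdist_le => e e0; near=> n.
have := hit_transform_tilde HQ (ltW lam0) n.
rewrite sumrB -mulr_suml -mulr_sumr.
have : 1 + (lam * e)^-1 <= \sum_(0 <= k < n) Ftilde Q (fun=> - lam) 0 k.
  by near: n; move/cvgryPge: (sum_Ftilde_cvgy HQ lam0 hit1); exact.
move: (\sum_(0 <= k < n) Ftilde _ _ _ _) (\sum_(0 <= k < n) dtilde _ _ _).
move=> SF Sd SFe wE; have /andP[V0 V1] := hit_transform_bounds HQ (ltW lam0) n.
have le0 : 0 < lam * e by rewrite mulr_gt0.
have SF0 : 0 < SF by rewrite (lt_le_trans _ SFe)// addr_gt0// invr_gt0.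
have -> : (1 - hit_transform Q lam 1) / lam - Sd / SF =
    (1 - hit_transform Q lam n) / (lam * SF).
  by rewrite wE; field; rewrite !gt_eqF.
rewrite ger0_norm; last by rewrite divr_ge0 ?subr_ge0// mulr_ge0// ltW.
rewrite ler_pdivrMr ?mulr_gt0// mulrA [e * _]mulrC.
apply: (@le_trans _ _ 1); first by rewrite lerBlDr lerDl.
rewrite -(mulfV (lt0r_neq0 le0)) ler_pM2l// (le_trans _ SFe)// lerDr.
exact: ler01.
Unshelve. all: by end_near. Qed.

Theorem proposition7p3 (R : realType) (Q : nat -> nat -> R)
    (HQ : single_birth_Qmatrix Q)
    (disp : measure_display) (T : measurableType disp)
    (P : nat -> probability T R) (X : R -> T -> option nat)
    (HX : markov_chain Q P X) (Hrec : recurrent_chain P X)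
    (lam : R) (lam_gt0 : 0 < lam) :
  let F : nat -> R := Ftilde Q (fun _ => - lam) 0 in
  let d : nat -> R := dtilde Q (fun _ => - lam) in
  let ratio (n : nat) : R :=
    (\sum_(0 <= k < n) d k) / (\sum_(0 <= k < n) F k) in
  let dlim : R := lim (ratio @ \oo) in
  let sigma0 : T -> \bar R := return_time X 0 in
  [/\ cvg (ratio @ \oo),
      laplace (P 0%N) sigma0 lam =
        (Q 0%N 1%N * (1 - lam * dlim) / (Q 0%N 1%N + lam))%:E,
      forall n : nat, (1 <= n)%N ->
        laplace (P n) sigma0 lam =
          (1 - lam * \sum_(0 <= k < n) (F k * dlim - d k))%:E &
      cvg ((fun n => d n / F n) @ \oo) ->
        dlim = lim ((fun n => d n / F n) @ \oo)].
Proof.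
move=> F d ratio dlim sigma0.
have [Y [S [mY mS XS law]]] := HX.
have YS n : jump_holding Q (P n) n Y S.
  by split=> // [m w|m i s s0]; [have [] := XS w|exact: law].
have hit1 : forall n, hit_transform Q 0 n = 1.
  apply: hit_transform_recurrent => //.
  (* Recurrence enters only through the certain return to 0 from 0. *)
  by have := Hrec 0%N; rewrite (prob_return_time HQ (YS 0%N) XS) => -[].
have ratio_cvg := tilde_ratio_cvg HQ lam_gt0 hit1.
have dlimE : dlim = (1 - hit_transform Q lam 1) / lam by exact: cvg_lim ratio_cvg.
have dlimM : lam * dlim = 1 - hit_transform Q lam 1.
  by rewrite dlimE mulrC divfK// gt_eqF.
split.
- by apply/cvg_ex; exists ((1 - hit_transform Q lam 1) / lam).
(* From 0 the only jump is to 1, so the transform is [q01 / (q01 + lam)] times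
   [hit_transform Q lam 1]. *)
- rewrite (laplace_return_time HQ (YS 0%N) XS lam_gt0) dlimM; congr (_%:E).
  have q01 := Qbirth_gt0 HQ 0.
  have q00 : - Q 0%N 0%N = Q 0%N 1%N.
    apply/eqP; rewrite eqr_oppLR -addr_eq0; apply/eqP.
    by rewrite -(row_sum0 HQ 0) 2?big_nat_recr//= big_geq// add0r.
  rewrite 2?big_nat_recr//= big_geq// add0r /discounted_jump /jump_prob /= q00.
  by field; rewrite !gt_eqF ?addr_gt0.
- case=> // n _; rewrite (laplace_return_time HQ (YS n.+1) XS lam_gt0).
  (* Away from 0 the return time is the hitting time of 0, so the sum after one step is
     [hit_transform] itself. *)
  rewrite -hit_transformS ?ltW//; congr (_%:E).
  have := hit_transform_tilde HQ (ltW lam_gt0) n.+1; rewrite -dlimM => wE.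
  rewrite mulr_sumr -[LHS](subKr 1) wE; congr (1 - _).
  by apply: eq_bigr => k _; rewrite /F /d; ring.
- move=> dF_cvg; apply: cvg_lim => //; apply: stolz_cesaro => //.
    exact: Ftilde0_gt0.
  exact: sum_Ftilde_cvgy.
Qed.
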